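(* Let $\alpha\neq0$ be a real number. For any rotational timelike $K^\alpha$-translator with spacelike axis the $x$-axis, parametrized by $X(r,\theta)=(f(r),r\cosh\theta,r\sinh\theta)$ and with speed normalized to $\vec v=(1,0,0)$, the function $f$ is $$f(r)=\begin{cases}\pm\displaystyle\int^r\Big(\frac1{m^2}e^{t^2}-1\Big)^{1/2}dt,\quad m>0, & \alpha=\frac12,\\[2mm] \pm\displaystyle\int^r\Big(\Big(m-\frac{2\alpha-1}{2\alpha}t^2\Big)^{\frac{2\alpha}{1-2\alpha}}-1\Big)^{1/2}dt,\quad m\in\mathbb R, & \alpha\neq\frac12.\end{cases}$$ The maximal domain of the function $f(r)$ is: 1. Case $\alpha=1/2$: $(0,\infty)$ if $m\le1$, or $(\sqrt{\log m^2},\infty)$ if $m>1$. 2. Case $\alpha\in(0,1/2)$: $(0,\infty)$ if $m\ge1$, or $\Big(\sqrt{\frac{2\alpha}{1-2\alpha}(1-m)},\infty\Big)$ if $m<1$. 3. Case $\alpha\notin[0,1/2]$: $\Big(0,\sqrt{\frac{2\alpha}{2\alpha-1}m}\Big)$ if $0<m\le1$, or $\Big(\sqrt{\frac{2\alpha}{2\alpha-1}(m-1)},\sqrt{\frac{2\alpha}{2\alpha-1}m}\Big)$ if $m>1$.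
   Context: $\mathbb R_1^3$ is $\mathbb R^3$ with the metric $\langle,\rangle=dx^2+dy^2-dz^2$. A surface is timelike if its induced metric is Lorentzian; then its (local) unit normal $N$ satisfies $\langle N,N\rangle=\epsilon=1$. The Gauss curvature is $K=\epsilon\det(A)$, where $AU=-\nabla^0_U N$ is the Weingarten map and $\nabla^0$ is the Levi-Civita connection of $\mathbb R_1^3$. In a local parametrization $X(u,v)$, $$K=-\frac{\det(X_u,X_v,X_{uu})\det(X_u,X_v,X_{vv})-\det(X_u,X_v,X_{uv})^2}{(EG-F^2)^2},$$ where $E=\langle X_u,X_u\rangle$, $F=\langle X_u,X_v\rangle$, $G=\langle X_v,X_v\rangle$. A timelike surface is a timelike $K^\alpha$-translator with speed $\vec v$ if $K>0$ and $K^\alpha=\langle N,\vec v\rangle$ everywhere, for a choice of unit normal $N$. In the parametrization $X(r,\theta)=(f(r),r\cosh\theta,r\sinh\theta)$, $f$ is smooth on an interval of $r>0$; this surface of revolution about the $x$-axis is always timelike. The symbol $\int^r$ denotes an antiderivative (defined up to an additive constant), and $m$ is a constant of integration. The maximal domain of $f$ is the largest open interval in $(0,\infty)$ on which the formula defines a smooth function for which $K>0$ and the translator equation holds; only the values of $m$ listed give a nonempty domain. *)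

(* Defs.v *)
From Stdlib Require Export Reals.
From Coquelicot Require Export Coquelicot.
Open Scope R_scope.

(** * Parametrized surfaces in Lorentz-Minkowski space *)

(* [Vec3] carries Coquelicot's product structure of real vector space
   ([plus], [opp], [scal] act coordinatewise). *)
Definition Vec3 : Type := (R * R * R)%type.

Definition crd1 (p : Vec3) : R := fst (fst p).
Definition crd2 (p : Vec3) : R := snd (fst p).
Definition crd3 (p : Vec3) : R := snd p.

Definition lorentz (p q : Vec3) : R :=
  crd1 p * crd1 q + crd2 p * crd2 q - crd3 p * crd3 q.

Definition Derive3 (c : R -> Vec3) (t : R) : Vec3 :=
  (Derive (fun s => crd1 (c s)) t,
   Derive (fun s => crd2 (c s)) t,
   Derive (fun s => crd3 (c s)) t).

Definition partial_u (X : R -> R -> Vec3) (u v : R) : Vec3 :=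
  Derive3 (fun s => X s v) u.
Definition partial_v (X : R -> R -> Vec3) (u v : R) : Vec3 :=
  Derive3 (fun s => X u s) v.

(* Meant for open [D]: all iterated partial derivatives of the coordinates
   exist and are continuous at the points of [D]. *)
Definition smooth_map (D : R -> R -> Prop) (X : R -> R -> Vec3) : Prop :=
  forall (n : nat) (u v : R), D u v ->
    ex_diff_n (fun s t => crd1 (X s t)) n u v /\
    ex_diff_n (fun s t => crd2 (X s t)) n u v /\
    ex_diff_n (fun s t => crd3 (X s t)) n u v.

(* The Gram matrix of the induced metric has negative determinant, i.e. the
   metric is Lorentzian; in particular [X] is an immersion at [(u, v)]. *)
Definition timelike_at (X : R -> R -> Vec3) (u v : R) : Prop :=
  lorentz (partial_u X u v) (partial_u X u v)
    * lorentz (partial_v X u v) (partial_v X u v)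
  - lorentz (partial_u X u v) (partial_v X u v) ^ 2 < 0.

Definition unit_normal_field (D : R -> R -> Prop) (X N : R -> R -> Vec3)
  : Prop :=
  smooth_map D N /\
  forall u v : R, D u v ->
    lorentz (N u v) (N u v) = 1 /\
    lorentz (N u v) (partial_u X u v) = 0 /\
    lorentz (N u v) (partial_v X u v) = 0.

(* [a11, a12, a21, a22] are the entries, in the basis [X_u, X_v], of the
   Weingarten map A, given by A X_u = - N_u and A X_v = - N_v. *)
Definition is_weingarten_matrix (X N : R -> R -> Vec3) (u v : R)
    (a11 a12 a21 a22 : R) : Prop :=
  (opp (partial_u N u v) : Vec3)
    = plus (scal a11 (partial_u X u v)) (scal a21 (partial_v X u v)) /\
  (opp (partial_v N u v) : Vec3)
    = plus (scal a12 (partial_u X u v)) (scal a22 (partial_v X u v)).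

(* K = epsilon det A with epsilon = <N, N>. Where [X_u, X_v] are independent
   the matrix, and so [k], is unique. *)
Definition is_gauss_curvature (X N : R -> R -> Vec3) (u v k : R) : Prop :=
  exists a11 a12 a21 a22 : R,
    is_weingarten_matrix X N u v a11 a12 a21 a22 /\
    k = lorentz (N u v) (N u v) * (a11 * a22 - a12 * a21).

Definition timelike_translator (alpha : R) (speed : Vec3)
    (D : R -> R -> Prop) (X : R -> R -> Vec3) : Prop :=
  smooth_map D X /\
  (forall u v : R, D u v -> timelike_at X u v) /\
  exists N : R -> R -> Vec3,
    unit_normal_field D X N /\
    forall u v : R, D u v ->
      exists k : R,
        is_gauss_curvature X N u v k /\
        0 < k /\
        Rpower k alpha = lorentz (N u v) speed.

(** * Rotational surfaces about the x-axis *)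

Definition open_itv (a : R) (b : Rbar) (r : R) : Prop :=
  a < r /\ Rbar_lt r b.

Definition rot_surface (f : R -> R) (r theta : R) : Vec3 :=
  (f r, r * cosh theta, r * sinh theta).

Definition rotational_translator (alpha a : R) (b : Rbar) (f : R -> R)
  : Prop :=
  (forall (n : nat) (r : R), open_itv a b r -> ex_derive_n f n r) /\
  timelike_translator alpha (1, 0, 0) (fun r _ => open_itv a b r)
    (rot_surface f).

(** * The explicit profile functions *)

Definition power_base (alpha m t : R) : R :=
  m - (2 * alpha - 1) / (2 * alpha) * t ^ 2.

Definition radicand (alpha m t : R) : R :=
  if Req_EM_T alpha (1 / 2)
  then 1 / m ^ 2 * exp (t ^ 2) - 1
  else Rpower (power_base alpha m t) (2 * alpha / (1 - 2 * alpha)) - 1.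

(* [Rpower] and [sqrt] are total, so the condition that the formula makes
   sense at [t] has to be stated. *)
Definition formula_defined (alpha m t : R) : Prop :=
  (alpha <> 1 / 2 -> 0 < power_base alpha m t) /\ 0 <= radicand alpha m t.

(* On (a, b), [f] is an antiderivative of [sg] times the square root of the
   radicand; [sg] is the sign +1 or -1. *)
Definition is_profile (alpha m sg a : R) (b : Rbar) (f : R -> R) : Prop :=
  forall r : R, open_itv a b r ->
    formula_defined alpha m r /\
    is_derive f r (sg * sqrt (radicand alpha m r)).

Definition admissible_domain (alpha m sg a : R) (b : Rbar) : Prop :=
  0 <= a /\ Rbar_lt a b /\
  (exists f : R -> R, is_profile alpha m sg a b f) /\
  (forall f : R -> R,
     is_profile alpha m sg a b f -> rotational_translator alpha a b f).

Definition is_maximal_domain (alpha m sg a : R) (b : Rbar) : Prop :=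
  admissible_domain alpha m sg a b /\
  forall (a' : R) (b' : Rbar), admissible_domain alpha m sg a' b' ->
    forall r : R, open_itv a' b' r -> open_itv a b r.

(* Main.v *)
(* With p = 1 + f'^2, the condition <N, (1,0,0)> = K^alpha > 0 forces
   N = (1, -f' cosh, -f' sinh) / sqrt p, whence K = f' f'' / (r p^2) and the
   translator equation K^alpha = p^(-1/2) becomes p' = 2 r p^(2 - 1/(2 alpha)).
   This separates and integrates to p = 1 + radicand. Conversely, where p > 1,
   all functions involved are combinations of monomials t^i p^x (p-1)^y, a
   class that the ODE makes stable under differentiation, hence smooth. The
   domain ends where the radicand becomes negative or, for alpha outside
   [0, 1/2], where power_base reaches 0. *)

Require Import Defs.
From Stdlib Require Import Reals Lra Lia.
From Coquelicot Require Import Coquelicot.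
Open Scope R_scope.

(** The curvature formula is proved as an equivalence, so that one computation serves both
    directions: it evaluates the curvature of a given translator and produces the Weingarten matrix
    of a constructed one. The sign in front of the integral is global. Since r > 0, K > 0 gives f'
    f'' > 0, so f' has no zero and by the intermediate value theorem keeps one sign on the whole
    interval. The formula makes sense when the radicand is nonnegative, but the square root is
    smooth only where it is positive. The gap is closed at the level of intervals: every admissible
    interval carries a profile, so the formula is defined at each of its points, and these points
    lie in the closure of the claimed interval; an open interval contained in that closure avoids
    the endpoints. No study of the surface at a zero of the radicand is involved. Joint smoothness
    in (r, theta) reduces to one variable because each coordinate of the surface and of its normal
    is a function of r times a function of theta. *)

(** * Open intervals with a possibly infinite right end *)

Lemma open_itv_open (a : R) (b : Rbar) : open (open_itv a b).
Proof. exact (open_and _ _ (open_gt a) (open_Rbar_lt b)). Qed.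

Lemma open_itv_between (a : R) (b : Rbar) (r s t : R) :
  open_itv a b r -> open_itv a b s -> r <= t <= s -> open_itv a b t.
Proof.
  intros [Har _] [_ Hsb] [Hrt Hts]; split; [lra|].
  exact (Rbar_le_lt_trans t s b Hts Hsb).
Qed.

Lemma open_itv_nonempty (a : R) (b : Rbar) :
  Rbar_lt a b -> exists c, open_itv a b c.
Proof.
  unfold open_itv; destruct b as [b| |]; simpl; intros Hab.
  - exists ((a + b) / 2); lra.
  - exists (a + 1); split; [lra | exact Logic.I].
  - contradiction.
Qed.

Lemma open_itv_constant (a : R) (b : Rbar) (F : R -> R) :
  Rbar_lt a b -> (forall r, open_itv a b r -> is_derive F r 0) ->
  exists C, forall r, open_itv a b r -> F r = C.
Proof.
  intros Hab HF; destruct (open_itv_nonempty a b Hab) as [c Hc].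
  exists (F c); intros r Hr.
  destruct (Rtotal_order r c) as [H|[->|H]]; [|reflexivity|].
  - apply (eq_is_derive F r c); [|exact H].
    intros t Ht; exact (HF t (open_itv_between a b r c t Hr Hc Ht)).
  - symmetry; apply (eq_is_derive F c r); [|exact H].
    intros t Ht; exact (HF t (open_itv_between a b c r t Hc Hr Ht)).
Qed.

Lemma open_itv_sign (a : R) (b : Rbar) (g : R -> R) :
  Rbar_lt a b -> (forall r, open_itv a b r -> continuity_pt g r) ->
  (forall r, open_itv a b r -> g r <> 0) ->
  exists sg, (sg = 1 \/ sg = -1) /\ forall r, open_itv a b r -> 0 < sg * g r.
Proof.
  intros Hab Hcont Hneq.
  (* Quantifying over [sg] covers both orders of the points: a change from positive to negative for
     [sg] is a change from negative to positive for [- sg]. *)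
  assert (Hsame : forall sg r s, open_itv a b r -> open_itv a b s -> r < s ->
            (sg = 1 \/ sg = -1) -> ~ (sg * g r < 0 /\ 0 < sg * g s)).
  { intros sg r s Hr Hs Hrs Hsg [H1 H2].
    destruct (Ranalysis5.IVT_interv (fun t => sg * g t) r s) as [z [Hz Hz0]];
      [|exact Hrs|exact H1|exact H2|].
    - intros t Ht; apply continuity_pt_scal, Hcont.
      exact (open_itv_between a b r s t Hr Hs Ht).
    - apply (Hneq z (open_itv_between a b r s z Hr Hs Hz)).
      destruct Hsg as [-> | ->]; lra. }
  destruct (open_itv_nonempty a b Hab) as [c Hc].
  assert (Hsg : exists sg, (sg = 1 \/ sg = -1) /\ 0 < sg * g c).
  { destruct (Rdichotomy _ _ (Hneq c Hc)); [exists (-1) | exists 1]; lra. }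
  destruct Hsg as [sg [Hsg Hgc]].
  exists sg; split; [exact Hsg|]; intros r Hr.
  destruct (Rlt_or_le 0 (sg * g r)) as [H|H]; [exact H|exfalso].
  assert (Hr0 := Hneq r Hr).
  assert (Hlt : sg * g r < 0) by (destruct Hsg as [-> | ->]; lra).
  destruct (Rtotal_order r c) as [Hrc|[->|Hrc]]; [|lra|].
  - exact (Hsame sg r c Hr Hc Hrc Hsg (conj Hlt Hgc)).
  - apply (Hsame (- sg) c r Hc Hr Hrc); [lra|].
    split; lra.
Qed.

(** * Derivatives of powers and of higher order *)

Lemma is_derive_Rpower (P : R -> R) (dP x t : R) :
  is_derive P t dP -> 0 < P t ->
  is_derive (fun s => Rpower (P s) x) t (x * dP * Rpower (P t) (x - 1)).
Proof.
  intros HP Hpos.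
  evar_last.
  - apply (is_derive_comp (fun p => Rpower p x) P).
    + apply is_derive_Reals, derivable_pt_lim_power, Hpos.
    + exact HP.
  - unfold scal; simpl; unfold mult; simpl; ring.
Qed.

Lemma is_derive_pow_id (i : nat) (t : R) :
  is_derive (fun s : R => s ^ i) t (INR i * t ^ pred i).
Proof. evar_last; [apply is_derive_pow, is_derive_id|]. simpl; unfold one; simpl; ring. Qed.

Lemma Derive_n_Derive (f : R -> R) (n : nat) (t : R) :
  Derive_n (Derive f) n t = Derive_n f (S n) t.
Proof.
  assert (E := Derive_n_comp f n 1 t); rewrite Nat.add_1_r in E; exact E.
Qed.

(** [ex_derive_n f (S n)] unfolds to differentiability of [Derive_n f n], which exposes the last
    derivative taken. Here the first one is peeled off instead, so that an explicit formula for it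
    can drive an induction. Order 0 is separate because [ex_derive_n g 0] carries no information. *)
Lemma ex_derive_n_S_of_is_derive (f g : R -> R) (n : nat) (t : R) :
  locally t (fun s => is_derive f s (g s)) ->
  ex_derive_n g n t -> ex_derive_n f (S n) t.
Proof.
  intros Hfg Hg; destruct n as [|n].
  - exists (g t); exact (locally_singleton _ _ Hfg).
  - assert (H : ex_derive_n (Derive f) (S n) t).
    { apply ex_derive_n_ext_loc with (2 := Hg).
      apply filter_imp with (2 := Hfg); intros s Hs.
      symmetry; exact (is_derive_unique _ _ _ Hs). }
    apply ex_derive_ext with (2 := H); intros s.
    exact (Derive_n_Derive f n s).
Qed.

Lemma ex_derive_n_Derive (f : R -> R) (n : nat) (t : R) :
  ex_derive_n f (S n) t -> ex_derive_n (Derive f) n t.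
Proof.
  destruct n as [|n]; [intros _; exact Logic.I|].
  intros H; apply ex_derive_ext with (2 := H); intros s.
  symmetry; exact (Derive_n_Derive f n s).
Qed.

(** * Smoothness of monomials in t, P and P - 1 *)

Section ProfileMonomials.

Variables (I : R -> Prop) (P : R -> R) (beta : R).
Hypothesis I_open : open I.
Hypothesis P_gt1 : forall t, I t -> 1 < P t.
Hypothesis P_ode : forall t, I t -> is_derive P t (2 * t * Rpower (P t) beta).

Definition monomial (i : nat) (x y t : R) : R :=
  t ^ i * Rpower (P t) x * Rpower (P t - 1) y.

(** Each differentiation of [P] contributes [2 * t * Rpower (P t) beta], whence [S i] and the shift
    by [beta]. At [i = 0] the value [pred 0 = 0] is harmless, its coefficient [INR 0] being zero. *)
Lemma is_derive_monomial (i : nat) (x y t : R) : I t ->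
  is_derive (monomial i x y) t
    (INR i * monomial (pred i) x y t
     + (2 * x * monomial (S i) (x - 1 + beta) y t
        + 2 * y * monomial (S i) (x + beta) (y - 1) t)).
Proof.
  intros Ht; assert (H1 := P_gt1 t Ht); unfold monomial.
  evar_last.
  - apply @is_derive_mult; [apply @is_derive_mult| |].
    + apply is_derive_pow_id.
    + apply is_derive_Rpower; [exact (P_ode t Ht) | lra].
    + exact Rmult_comm.
    + apply is_derive_Rpower; [|lra].
      apply @is_derive_minus; [exact (P_ode t Ht) | apply is_derive_const].
    + exact Rmult_comm.
  - unfold plus, minus, mult, opp, zero; simpl.
    unfold plus, mult, opp; simpl.
    rewrite !Rpower_plus; simpl; ring.
Qed.

Lemma monomial_smooth (n i : nat) (x y t : R) :
  I t -> ex_derive_n (monomial i x y) n t.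
Proof.
  revert n i x y t.
  (* Differentiation changes the exponents, so they are generalized; [ex_derive_n_plus] asks for all
     lower orders on a neighbourhood, so the induction carries every [k <= n] and every point of
     [I]. *)
  assert (Hall : forall n k, (k <= n)%nat -> forall i x y t,
            I t -> ex_derive_n (monomial i x y) k t).
  { induction n as [|n IH]; intros k Hk i x y t Ht.
    - replace k with 0%nat by lia; exact Logic.I.
    - destruct k as [|k]; [exact Logic.I|].
      eapply ex_derive_n_S_of_is_derive.
      + apply filter_imp with (2 := I_open t Ht); intros s Hs.
        exact (is_derive_monomial i x y s Hs).
      + assert (Hloc : forall c j x' y', locally t (fun s => forall l,
                  (l <= k)%nat -> ex_derive_n (fun s => c * monomial j x' y' s) l s)).
        { intros c j x' y'; apply filter_imp with (2 := I_open t Ht).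
          intros s Hs l Hl; apply ex_derive_n_scal_l, IH; [lia | exact Hs]. }
        apply ex_derive_n_plus; [apply Hloc|].
        apply filter_imp with (2 := I_open t Ht); intros s Hs l Hl.
        apply ex_derive_n_plus;
          (apply filter_imp with (2 := I_open s Hs); intros s' Hs' l' Hl';
           apply ex_derive_n_scal_l, IH; [lia | exact Hs']). }
  intros n i x y t Ht; exact (Hall n n (le_n n) i x y t Ht).
Qed.

End ProfileMonomials.

(** * Joint smoothness of products g(s) h(t) *)

Lemma is_derive_cosh (t : R) : is_derive cosh t (sinh t).
Proof. apply is_derive_Reals, derivable_pt_lim_cosh. Qed.

Lemma is_derive_sinh (t : R) : is_derive sinh t (cosh t).
Proof. apply is_derive_Reals, derivable_pt_lim_sinh. Qed.

Lemma cosh_sinh_smooth (n : nat) (t : R) :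
  ex_derive_n cosh n t /\ ex_derive_n sinh n t.
Proof.
  revert t; induction n as [|n IH]; intros t; [split; exact Logic.I|].
  split; eapply ex_derive_n_S_of_is_derive.
  - apply filter_forall; exact is_derive_cosh.
  - apply IH.
  - apply filter_forall; exact is_derive_sinh.
  - apply IH.
Qed.

(** A partial derivative differentiates one factor and leaves the other, so the class of products is
    stable. The factor [g] holds profile data and lives on [I]; [h] is 1, [cosh] or [sinh]. *)
Lemma ex_diff_n_separable (I : R -> Prop) (g h : R -> R) (n : nat) (u v : R) :
  (forall k t, I t -> ex_derive_n g k t) ->
  (forall k t, ex_derive_n h k t) ->
  I u -> ex_diff_n (fun s t => g s * h t) n u v.
Proof.
  revert g h; induction n as [|n IH]; intros g h Hg Hh Hu.
  all: assert (Hg1 : ex_derive g u) by exact (Hg 1%nat u Hu).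
  all: assert (Hh1 : ex_derive h v) by exact (Hh 1%nat v).
  all: assert (Hc : continuity_2d_pt (fun s t => g s * h t) u v).
  1, 3: apply continuity_2d_pt_mult.
  1, 3: apply (continuity_1d_2d_pt_comp g (fun s _ => s)).
  5, 6: apply (continuity_1d_2d_pt_comp h (fun _ t => t)).
  all: try apply continuity_2d_pt_id1; try apply continuity_2d_pt_id2.
  1-4: apply continuity_pt_filterlim, (ex_derive_continuous (V := R_NormedModule));
    assumption.
  - split; [exact Hc | exact Logic.I].
  - split; [exact Hc|split; [|split; [|split]]].
    + apply ex_derive_mult; [exact Hg1 | apply ex_derive_const].
    + apply ex_derive_mult; [apply ex_derive_const | exact Hh1].
    + apply ex_diff_n_ext_loc with (fun s t => Derive g s * h t).
      * apply locally_2d_forall; intros s t; symmetry; apply Derive_scal_l.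
      * apply IH; [|exact Hh|exact Hu].
        intros k t Ht; apply ex_derive_n_Derive, Hg, Ht.
    + apply ex_diff_n_ext_loc with (fun s t => g s * Derive h t).
      * apply locally_2d_forall; intros s t; symmetry; apply Derive_scal.
      * apply IH; [exact Hg| |exact Hu].
        intros k t; apply ex_derive_n_Derive, Hh.
Qed.

Lemma cosh_sqr_eq (t : R) : cosh t ^ 2 = 1 + sinh t ^ 2.
Proof.
  unfold cosh, sinh; assert (H : exp t * exp (- t) = 1).
  { rewrite <- exp_plus, Rplus_opp_r; exact exp_0. }
  nra.
Qed.

(** * Normal and Gauss curvature of a rotational surface *)

Lemma partial_u_rot_surface (f : R -> R) (u v : R) :
  partial_u (rot_surface f) u v = (Derive f u, cosh v, sinh v).
Proof.
  unfold partial_u, Derive3, rot_surface, crd1, crd2, crd3; simpl.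
  rewrite !Derive_scal_l, !Derive_id, !Rmult_1_l; reflexivity.
Qed.

Lemma partial_v_rot_surface (f : R -> R) (u v : R) :
  partial_v (rot_surface f) u v = (0, u * sinh v, u * cosh v).
Proof.
  unfold partial_v, Derive3, rot_surface, crd1, crd2, crd3; simpl.
  rewrite !Derive_scal, Derive_const.
  rewrite (is_derive_unique _ _ _ (is_derive_cosh v)).
  rewrite (is_derive_unique _ _ _ (is_derive_sinh v)); reflexivity.
Qed.

(** The Gram determinant is [- u ^ 2 * (1 + Derive f u ^ 2)], by [cosh ^ 2 - sinh ^ 2 = 1]. *)
Lemma rot_surface_timelike (f : R -> R) (u v : R) :
  u <> 0 -> timelike_at (rot_surface f) u v.
Proof.
  intros Hu; unfold timelike_at.
  rewrite partial_u_rot_surface, partial_v_rot_surface.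
  unfold lorentz, crd1, crd2, crd3; simpl.
  assert (Hc := cosh_sqr_eq v).
  set (d := Derive f u); set (c := cosh v) in *; set (s := sinh v) in *.
  assert (H2 : 0 < u ^ 2) by (apply pow2_gt_0; exact Hu).
  replace (_ - _) with (- (u ^ 2 * (d ^ 2 + (c ^ 2 - s ^ 2)) * (c ^ 2 - s ^ 2)))
    by ring.
  rewrite Hc; nra.
Qed.

(** [g] stands for the slope f'. Of the two unit normals this is the one with positive product with
    (1, 0, 0). *)
Definition rot_normal (g : R -> R) (r theta : R) : Vec3 :=
  (/ sqrt (1 + g r ^ 2),
   - (g r / sqrt (1 + g r ^ 2)) * cosh theta,
   - (g r / sqrt (1 + g r ^ 2)) * sinh theta).

Lemma rot_normal_unit (f : R -> R) (u v : R) :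
  let n := rot_normal (Derive f) u v in
  lorentz n n = 1 /\
  lorentz n (partial_u (rot_surface f) u v) = 0 /\
  lorentz n (partial_v (rot_surface f) u v) = 0.
Proof.
  intros n; unfold n; rewrite partial_u_rot_surface, partial_v_rot_surface.
  unfold lorentz, rot_normal, crd1, crd2, crd3; cbn [fst snd].
  assert (Hc := cosh_sqr_eq v).
  set (g := Derive f u).
  assert (HW : 0 < sqrt (1 + g ^ 2)) by (apply sqrt_lt_R0; nra).
  assert (HW2 : sqrt (1 + g ^ 2) ^ 2 = 1 + g ^ 2) by (apply pow2_sqrt; nra).
  set (W := sqrt (1 + g ^ 2)) in *.
  set (c := cosh v) in *; set (s := sinh v) in *.
  repeat split.
  - replace (_ - _) with ((1 + g ^ 2 * (c ^ 2 - s ^ 2)) / W ^ 2) by (field; lra).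
    rewrite Hc, HW2; field; nra.
  - replace (_ - _) with (g / W * (1 - (c ^ 2 - s ^ 2))) by (field; lra).
    rewrite Hc; ring.
  - ring.
Qed.

(** Orthogonality to X_v makes (n2, n3) a multiple of (cosh, sinh), orthogonality to X_u makes the
    factor [- (n1 * g)], and unit length gives [n1] up to the sign that [0 < crd1 n] settles. *)
Lemma rot_normal_unique (f : R -> R) (u v : R) (n : Vec3) :
  u <> 0 ->
  lorentz n n = 1 ->
  lorentz n (partial_u (rot_surface f) u v) = 0 ->
  lorentz n (partial_v (rot_surface f) u v) = 0 ->
  0 < crd1 n ->
  n = rot_normal (Derive f) u v.
Proof.
  intros Hu; rewrite partial_u_rot_surface, partial_v_rot_surface.
  destruct n as [[n1 n2] n3].
  unfold lorentz, rot_normal, crd1, crd2, crd3; cbn [fst snd].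
  assert (Hc := cosh_sqr_eq v).
  set (g := Derive f u); set (c := cosh v) in *; set (s := sinh v) in *.
  intros Hn Hnu Hnv Hpos.
  assert (Hort : n2 * s - n3 * c = 0).
  { apply (Rmult_eq_reg_l u); [rewrite Rmult_0_r, <- Hnv; ring | exact Hu]. }
  assert (H2 : n2 = - (n1 * g) * c).
  (* Multiplying by [c ^ 2 - s ^ 2], which is 1, brings out the two combinations of [n2] and [n3]
     known from orthogonality. *)
  { transitivity (n2 * (c ^ 2 - s ^ 2)); [rewrite Hc; ring|].
    replace (n2 * (c ^ 2 - s ^ 2))
      with ((n2 * c - n3 * s) * c - (n2 * s - n3 * c) * s) by ring.
    rewrite Hort; replace (n2 * c - n3 * s) with (- (n1 * g)) by lra; ring. }
  assert (H3 : n3 = - (n1 * g) * s).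
  { transitivity (n3 * (c ^ 2 - s ^ 2)); [rewrite Hc; ring|].
    replace (n3 * (c ^ 2 - s ^ 2))
      with ((n2 * c - n3 * s) * s - (n2 * s - n3 * c) * c) by ring.
    rewrite Hort; replace (n2 * c - n3 * s) with (- (n1 * g)) by lra; ring. }
  assert (Hn1 : n1 ^ 2 * (1 + g ^ 2) = 1).
  { etransitivity; [|exact Hn]; rewrite H2, H3; symmetry.
    replace (_ - _) with (n1 ^ 2 * (1 + g ^ 2 * (c ^ 2 - s ^ 2))) by ring.
    rewrite Hc; ring. }
  assert (HW : 0 < sqrt (1 + g ^ 2)) by (apply sqrt_lt_R0; nra).
  assert (E1 : n1 = / sqrt (1 + g ^ 2)).
  { apply (Rmult_eq_reg_r (sqrt (1 + g ^ 2))); [|lra].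
    rewrite Rinv_l by lra.
    rewrite <- (sqrt_pow2 n1) at 1 by lra.
    rewrite <- sqrt_mult by nra.
    rewrite Hn1; exact sqrt_1. }
  rewrite H2, H3, E1; unfold Rdiv; rewrite (Rmult_comm g); reflexivity.
Qed.

Lemma is_derive_inv_sqrt_1_sqr (g : R -> R) (dg t : R) :
  is_derive g t dg ->
  is_derive (fun s : R => / sqrt (1 + g s ^ 2)) t
    (- (g t * dg / sqrt (1 + g t ^ 2) ^ 3)).
Proof.
  intros Hg.
  assert (HW : 0 < sqrt (1 + g t ^ 2)) by (apply sqrt_lt_R0; nra).
  auto_derive.
  - replace (1 + g t * (g t * 1)) with (1 + g t ^ 2) by ring.
    repeat split; [exists dg; exact Hg | nra | lra].
  - replace (Derive (fun s : R => g s) t) with dg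
      by (symmetry; exact (is_derive_unique _ _ _ Hg)).
    replace (1 + g t * (g t * 1)) with (1 + g t ^ 2) by ring.
    field; lra.
Qed.

Lemma is_derive_slope_over_sqrt (g : R -> R) (dg t : R) :
  is_derive g t dg ->
  is_derive (fun s : R => g s / sqrt (1 + g s ^ 2)) t (dg / sqrt (1 + g t ^ 2) ^ 3).
Proof.
  intros Hg.
  assert (HW : 0 < sqrt (1 + g t ^ 2)) by (apply sqrt_lt_R0; nra).
  assert (HW2 : sqrt (1 + g t ^ 2) ^ 2 = 1 + g t ^ 2) by (apply pow2_sqrt; nra).
  evar_last.
  - apply @is_derive_mult; [exact Hg | | exact Rmult_comm].
    apply is_derive_inv_sqrt_1_sqr, Hg.
  - unfold plus, mult; simpl.
    replace (g t * (g t * 1)) with (g t ^ 2) by ring.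
    set (W := sqrt (1 + g t ^ 2)) in *.
    transitivity (dg * (W ^ 2 - g t ^ 2) / W ^ 3); [field; lra|].
    rewrite HW2; field; lra.
Qed.

(** Trades the vector space operations of [Vec3] for real equations, one pair per coordinate, which
    field arithmetic can treat. *)
Lemma weingarten_matrix_iff (X N : R -> R -> Vec3) (u v a11 a12 a21 a22 : R) :
  is_weingarten_matrix X N u v a11 a12 a21 a22 <->
  (forall crd, crd = crd1 \/ crd = crd2 \/ crd = crd3 ->
     - crd (partial_u N u v)
       = a11 * crd (partial_u X u v) + a21 * crd (partial_v X u v) /\
     - crd (partial_v N u v)
       = a12 * crd (partial_u X u v) + a22 * crd (partial_v X u v)).
Proof.
  unfold is_weingarten_matrix.
  destruct (partial_u N u v) as [[n1 n2] n3], (partial_v N u v) as [[n1' n2'] n3'].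
  destruct (partial_u X u v) as [[x1 x2] x3], (partial_v X u v) as [[y1 y2] y3].
  split.
  - intros [Hu Hv] crd Hcrd; split.
    + destruct Hcrd as [-> | [-> | ->]].
      * exact (f_equal crd1 Hu).
      * exact (f_equal crd2 Hu).
      * exact (f_equal crd3 Hu).
    + destruct Hcrd as [-> | [-> | ->]].
      * exact (f_equal crd1 Hv).
      * exact (f_equal crd2 Hv).
      * exact (f_equal crd3 Hv).
  - intros H.
    destruct (H crd1) as [Hu1 Hv1]; [auto|].
    destruct (H crd2) as [Hu2 Hv2]; [auto|].
    destruct (H crd3) as [Hu3 Hv3]; [auto|].
    unfold crd1, crd2, crd3 in *; cbn [fst snd] in *; split.
    + transitivity ((- n1, - n2, - n3) : Vec3); [reflexivity|].
      rewrite Hu1, Hu2, Hu3; reflexivity.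
    + transitivity ((- n1', - n2', - n3') : Vec3); [reflexivity|].
      rewrite Hv1, Hv2, Hv3; reflexivity.
Qed.

(** The Weingarten matrix is diagonal, with principal curvatures f'' / W^3 along the profile and f'
    / (u W) along the rotation, where W^2 = 1 + f'^2. [N] is known only over [I]: openness of [I]
    transfers its derivative in [u], while the derivative in [v] stays over the same point of
    [I]. *)
Lemma rot_gauss_curvature (f : R -> R) (I : R -> Prop) (N : R -> R -> Vec3)
    (u v d2 k : R) :
  open I -> (forall s t, I s -> N s t = rot_normal (Derive f) s t) ->
  I u -> u <> 0 -> is_derive (Derive f) u d2 ->
  is_gauss_curvature (rot_surface f) N u v k <->
  k = Derive f u * d2 / (u * (1 + Derive f u ^ 2) ^ 2).
Proof.
  intros HI HN Hu Hu0 Hd2.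
  assert (HNu : partial_u N u v = partial_u (rot_normal (Derive f)) u v).
  { unfold partial_u, Derive3; (apply f_equal2; [apply f_equal2|]); apply Derive_ext_loc;
      apply filter_imp with (2 := HI u Hu); intros s Hs; rewrite HN; auto. }
  assert (HNv : partial_v N u v = partial_v (rot_normal (Derive f)) u v).
  { unfold partial_v, Derive3; (apply f_equal2; [apply f_equal2|]); apply Derive_ext;
      intros s; rewrite HN; auto. }
  assert (EN : lorentz (N u v) (N u v) = 1).
  { rewrite HN by exact Hu; apply rot_normal_unit. }
  assert (Hweingarten : forall a11 a12 a21 a22,
            is_weingarten_matrix (rot_surface f) N u v a11 a12 a21 a22 <->
            let g := Derive f u in let W := sqrt (1 + g ^ 2) in
            (g * d2 / W ^ 3 = a11 * g /\
             d2 / W ^ 3 * cosh v = a11 * cosh v + a21 * (u * sinh v) /\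
             d2 / W ^ 3 * sinh v = a11 * sinh v + a21 * (u * cosh v)) /\
            (0 = a12 * g /\
             g / W * sinh v = a12 * cosh v + a22 * (u * sinh v) /\
             g / W * cosh v = a12 * sinh v + a22 * (u * cosh v))).
  { intros a11 a12 a21 a22; rewrite weingarten_matrix_iff, HNu, HNv.
    assert (E1 : partial_u (rot_normal (Derive f)) u v
                 = (- (Derive f u * d2 / sqrt (1 + Derive f u ^ 2) ^ 3),
                    - (d2 / sqrt (1 + Derive f u ^ 2) ^ 3) * cosh v,
                    - (d2 / sqrt (1 + Derive f u ^ 2) ^ 3) * sinh v)).
    { unfold partial_u, Derive3, rot_normal, crd1, crd2, crd3; cbn [fst snd].
      rewrite !Derive_scal_l, !Derive_opp.
      rewrite (is_derive_unique _ _ _ (is_derive_inv_sqrt_1_sqr _ _ _ Hd2)).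
      rewrite (is_derive_unique _ _ _ (is_derive_slope_over_sqrt _ _ _ Hd2)).
      reflexivity. }
    assert (E2 : partial_v (rot_normal (Derive f)) u v
                 = (0, - (Derive f u / sqrt (1 + Derive f u ^ 2)) * sinh v,
                       - (Derive f u / sqrt (1 + Derive f u ^ 2)) * cosh v)).
    { unfold partial_v, Derive3, rot_normal, crd1, crd2, crd3; cbn [fst snd].
      rewrite !Derive_scal, Derive_const.
      rewrite (is_derive_unique _ _ _ (is_derive_cosh v)).
      rewrite (is_derive_unique _ _ _ (is_derive_sinh v)).
      reflexivity. }
    rewrite E1, E2, partial_u_rot_surface, partial_v_rot_surface; cbv zeta.
    split.
    - intros H.
      assert (H1 := H crd1 (or_introl eq_refl)).
      assert (H2 := H crd2 (or_intror (or_introl eq_refl))).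
      assert (H3 := H crd3 (or_intror (or_intror eq_refl))).
      unfold crd1, crd2, crd3 in *; cbn [fst snd] in *; lra.
    - intros H crd [-> | [-> | ->]]; unfold crd1, crd2, crd3; cbn [fst snd]; lra. }
  unfold is_gauss_curvature; rewrite EN.
  setoid_rewrite Hweingarten; cbv zeta; clear Hweingarten.
  assert (Hc := cosh_sqr_eq v).
  set (g := Derive f u) in *; set (c := cosh v) in *; set (s := sinh v) in *.
  assert (HW : 0 < sqrt (1 + g ^ 2)) by (apply sqrt_lt_R0; nra).
  assert (HW2 : sqrt (1 + g ^ 2) ^ 2 = 1 + g ^ 2) by (apply pow2_sqrt; nra).
  set (W := sqrt (1 + g ^ 2)) in *; rewrite <- HW2.
  split.
  - intros [a11 [a12 [a21 [a22 [[[_ [Hx2 Hx3]] [_ [Hy2 Hy3]]] Hk]]]]].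
    assert (H11 : a11 = d2 / W ^ 3).
    (* Combining the second and third coordinates with weights [c] and [s] isolates one matrix entry
       at a time. *)
    { transitivity (a11 * (c ^ 2 - s ^ 2)); [rewrite Hc; ring|].
      transitivity ((a11 * c + a21 * (u * s)) * c - (a11 * s + a21 * (u * c)) * s);
        [ring|].
      rewrite <- Hx2, <- Hx3.
      transitivity (d2 / W ^ 3 * (c ^ 2 - s ^ 2)); [ring | rewrite Hc; ring]. }
    assert (H12 : a12 = 0).
    { transitivity (a12 * (c ^ 2 - s ^ 2)); [rewrite Hc; ring|].
      transitivity ((a12 * c + a22 * (u * s)) * c - (a12 * s + a22 * (u * c)) * s);
        [ring|].
      rewrite <- Hy2, <- Hy3; ring. }
    assert (H22 : u * a22 = g / W).
    { transitivity (u * a22 * (c ^ 2 - s ^ 2)); [rewrite Hc; ring|].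
      transitivity ((a12 * s + a22 * (u * c)) * c - (a12 * c + a22 * (u * s)) * s);
        [ring|].
      rewrite <- Hy2, <- Hy3.
      transitivity (g / W * (c ^ 2 - s ^ 2)); [ring | rewrite Hc; ring]. }
    rewrite Hk, H11, H12.
    replace a22 with (g / W / u) by (rewrite <- H22; field; exact Hu0).
    field; split; lra || exact Hu0.
  - intros ->; exists (d2 / W ^ 3), 0, 0, (g / (u * W)).
    repeat split; field; try split; lra || exact Hu0.
Qed.

(** * The differential equation for p = 1 + f'^2 and its integration *)

Lemma Rpower_eq_inv_sqrt_iff (alpha p k : R) : alpha <> 0 -> 0 < p -> 0 < k ->
  Rpower k alpha = / sqrt p <-> k = Rpower p (- / (2 * alpha)).
Proof.
  intros Ha Hp Hk.
  assert (E : / sqrt p = Rpower p (- / 2)).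
  { rewrite Rpower_Ropp, Rpower_sqrt by exact Hp; reflexivity. }
  rewrite E; split.
  - intros H; rewrite <- (Rpower_1 k Hk).
    replace 1 with (alpha * / alpha) by (field; exact Ha).
    rewrite <- Rpower_mult, H, Rpower_mult; f_equal; field; exact Ha.
  - intros ->; rewrite Rpower_mult; f_equal; field; exact Ha.
Qed.

(** At [alpha = 1 / 2] the exponent [2 - / (2 * alpha)] is 1 and the equation is linear. Otherwise,
    with [q] the exponent in [radicand], [q * (2 - / (2 * alpha)) = q - 1] is the exponent that the
    power rule leaves. *)
Lemma is_derive_radicand (alpha m t : R) :
  alpha <> 0 -> (alpha = 1 / 2 -> 0 < m) ->
  (alpha <> 1 / 2 -> 0 < power_base alpha m t) ->
  is_derive (radicand alpha m) t
    (2 * t * Rpower (1 + radicand alpha m t) (2 - / (2 * alpha))).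
Proof.
  intros Ha Hm Hbase; unfold radicand.
  destruct (Req_EM_T alpha (1 / 2)) as [E|E].
  - specialize (Hm E).
    replace (1 + (1 / m ^ 2 * exp (t ^ 2) - 1)) with (exp (t ^ 2) / m ^ 2)
      by (field; lra).
    replace (2 - / (2 * alpha)) with 1 by (rewrite E; field).
    rewrite Rpower_1.
    + auto_derive; [exact I|].
      replace (t * (t * 1)) with (t ^ 2) by ring; field; lra.
    + apply Rdiv_lt_0_compat; [apply exp_pos | apply pow_lt; exact Hm].
  - specialize (Hbase E).
    assert (H1 : 1 - 2 * alpha <> 0) by lra.
    set (q := 2 * alpha / (1 - 2 * alpha)).
    replace (1 + (Rpower (power_base alpha m t) q - 1))
      with (Rpower (power_base alpha m t) q) by ring.
    rewrite Rpower_mult.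
    replace (q * (2 - / (2 * alpha))) with (q - 1)
      by (unfold q; field; split; assumption).
    evar_last.
    + apply @is_derive_minus; [|apply is_derive_const].
      apply is_derive_Rpower; [|exact Hbase].
      instantiate (1 := - (2 * ((2 * alpha - 1) / (2 * alpha)) * t)).
      unfold power_base; auto_derive; [exact I | simpl; ring].
    + unfold minus, plus, opp, zero; simpl.
      rewrite Ropp_0, Rplus_0_r; unfold q; field; split; assumption.
Qed.

Lemma slope_ode_solution (alpha a : R) (b : Rbar) (P : R -> R) :
  alpha <> 0 -> Rbar_lt a b -> (forall r, open_itv a b r -> 0 < P r) ->
  (forall r, open_itv a b r ->
     is_derive P r (2 * r * Rpower (P r) (2 - / (2 * alpha)))) ->
  exists m, (alpha = 1 / 2 -> 0 < m) /\
    forall r, open_itv a b r ->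
      (alpha <> 1 / 2 -> 0 < power_base alpha m r) /\
      radicand alpha m r = P r - 1.
Proof.
  intros Ha Hab Hpos Hode; unfold radicand.
  destruct (Req_EM_T alpha (1 / 2)) as [E|E].
  - destruct (open_itv_constant a b (fun r => ln (P r) - r ^ 2) Hab) as [C HC].
    { intros r Hr; specialize (Hode r Hr); specialize (Hpos r Hr).
      replace (2 - / (2 * alpha)) with 1 in Hode by (rewrite E; field).
      rewrite Rpower_1 in Hode by exact Hpos.
      evar_last.
      - apply @is_derive_minus; [|apply is_derive_pow_id].
        apply (is_derive_comp ln P); [apply is_derive_ln, Hpos | exact Hode].
      - unfold minus, plus, opp, scal; simpl; unfold mult; simpl; field; lra. }
    (* Since P = exp (C + r^2), the constant must satisfy [1 / m ^ 2 = exp C]. *)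
    exists (exp (- (C / 2))); split; [intros _; apply exp_pos|].
    intros r Hr; split; [contradiction|]; f_equal.
    rewrite <- (exp_ln (P r)) by exact (Hpos r Hr).
    replace (ln (P r)) with (C + r ^ 2) by (rewrite <- (HC r Hr); ring).
    replace (exp (- (C / 2)) ^ 2) with (/ exp C).
    + rewrite exp_plus; field; apply Rgt_not_eq, exp_pos.
    + rewrite <- exp_Ropp; simpl; rewrite Rmult_1_r, <- exp_plus.
      f_equal; field.
  - assert (H1 : 1 - 2 * alpha <> 0) by lra.
    (* [e] is 1 minus the exponent of the equation, so P^e has a derivative linear in r; it is also
       the reciprocal of the exponent in [radicand]. Hence [power_base] is P^e, positive as a value
       of [exp]. *)
    set (e := (1 - 2 * alpha) / (2 * alpha)).
    destruct (open_itv_constant a b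
      (fun r => Rpower (P r) e + (2 * alpha - 1) / (2 * alpha) * r ^ 2) Hab)
      as [m Hm].
    { intros r Hr; specialize (Hode r Hr); specialize (Hpos r Hr).
      evar_last.
      - apply @is_derive_plus; [apply is_derive_Rpower; [exact Hode | exact Hpos]|].
        apply is_derive_scal, is_derive_pow_id.
      - unfold plus; simpl.
        transitivity (e * (2 * r) * Rpower (P r) (2 - / (2 * alpha) + (e - 1))
                      + (2 * alpha - 1) / (2 * alpha) * ((1 + 1) * (r * 1)));
          [rewrite Rpower_plus; ring|].
        replace (2 - / (2 * alpha) + (e - 1)) with 0 by (unfold e; field; exact Ha).
        rewrite Rpower_O by exact Hpos; unfold e; field; exact Ha. }
    exists m; split; [contradiction|]; intros r Hr.
    assert (Hbase : power_base alpha m r = Rpower (P r) e).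
    { unfold power_base; rewrite <- (Hm r Hr); ring. }
    rewrite Hbase; split; [intros _; apply exp_pos|].
    rewrite Rpower_mult.
    replace (e * (2 * alpha / (1 - 2 * alpha))) with 1
      by (unfold e; field; split; assumption).
    rewrite Rpower_1 by exact (Hpos r Hr); reflexivity.
Qed.

(** * Translators against explicit profiles *)

Lemma translator_slope_ode (alpha a : R) (b : Rbar) (f : R -> R) (r : R) :
  alpha <> 0 -> 0 <= a -> rotational_translator alpha a b f -> open_itv a b r ->
  Derive f r <> 0 /\
  is_derive (fun s => 1 + Derive f s ^ 2) r
    (2 * r * Rpower (1 + Derive f r ^ 2) (2 - / (2 * alpha))).
Proof.
  intros Ha Ha0 [Hsmooth [_ [_ [N [[_ HN] HK]]]]] Hr.
  assert (Hspeed : forall u v, lorentz (N u v) (1, 0, 0) = crd1 (N u v)).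
  { intros u v; unfold lorentz, crd1, crd2, crd3; simpl; ring. }
  assert (HNrot : forall s t, open_itv a b s -> N s t = rot_normal (Derive f) s t).
  { intros s t Hs; destruct (HN s t Hs) as [H1 [H2 H3]].
    apply rot_normal_unique; try assumption.
    - destruct Hs; lra.
    - destruct (HK s t Hs) as [k [_ [_ Hk]]].
      rewrite <- Hspeed, <- Hk; apply exp_pos. }
  assert (Hr0 : 0 < r) by (destruct Hr; lra).
  assert (Hd2 : is_derive (Derive f) r (Derive (Derive f) r)).
  { apply Derive_correct; exact (Hsmooth 2%nat r Hr). }
  set (d2 := Derive (Derive f) r) in *.
  (* The curvature does not depend on the angle, so angle 0 represents the whole parallel. *)
  destruct (HK r 0 Hr) as [k [Hk [Hkpos Hkpow]]].
  apply (rot_gauss_curvature f (open_itv a b) N r 0 d2) in Hk;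
    [|apply open_itv_open|exact HNrot|exact Hr|lra|exact Hd2].
  rewrite Hspeed, HNrot in Hkpow by exact Hr.
  set (g := Derive f r) in *.
  assert (Hp : 0 < 1 + g ^ 2) by nra.
  change (Rpower k alpha = / sqrt (1 + g ^ 2)) in Hkpow.
  apply Rpower_eq_inv_sqrt_iff in Hkpow; [|exact Ha|exact Hp|exact Hkpos].
  split.
  - intros Hg; rewrite Hk, Hg in Hkpos; unfold Rdiv in Hkpos.
    rewrite !Rmult_0_l in Hkpos; lra.
  - evar_last.
    + apply @is_derive_plus; [apply is_derive_const | apply is_derive_pow, Hd2].
    + unfold plus, zero; simpl; fold g.
      replace (g * (g * 1)) with (g ^ 2) by ring.
      (* The first summand of the exponent yields [k] by the translator equation, the second yields
         p^2, and k p^2 = f' f'' / r. *)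
      replace (2 - / (2 * alpha)) with (- / (2 * alpha) + INR 2) by (simpl; ring).
      rewrite Rpower_plus, Rpower_pow, <- Hkpow, Hk by exact Hp.
      simpl; field; split; lra.
Qed.

Lemma translator_is_profile (alpha a : R) (b : Rbar) (f : R -> R) :
  alpha <> 0 -> 0 <= a -> Rbar_lt a b -> rotational_translator alpha a b f ->
  exists sg m : R, (sg = 1 \/ sg = -1) /\ (alpha = 1 / 2 -> 0 < m) /\
    is_profile alpha m sg a b f.
Proof.
  intros Ha Ha0 Hab Hf.
  assert (Hode := fun r => translator_slope_ode alpha a b f r Ha Ha0 Hf).
  destruct Hf as [Hsmooth _].
  destruct (open_itv_sign a b (Derive f) Hab) as [sg [Hsg Hpos]].
  { intros r Hr; apply continuity_pt_filterlim.
    apply (ex_derive_continuous (V := R_NormedModule)), (Hsmooth 2%nat r Hr). }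
  { intros r Hr; exact (proj1 (Hode r Hr)). }
  destruct (slope_ode_solution alpha a b (fun r => 1 + Derive f r ^ 2) Ha Hab)
    as [m [Hm Hsol]].
  { intros r _; nra. }
  { intros r Hr; exact (proj2 (Hode r Hr)). }
  exists sg, m; split; [exact Hsg|split; [exact Hm|]].
  intros r Hr; destruct (Hsol r Hr) as [Hbase Hrad].
  unfold formula_defined; rewrite Hrad.
  specialize (Hpos r Hr).
  (* As the square of the positive number [sg * Derive f r], the radicand has that number as its
     square root. *)
  replace (1 + Derive f r ^ 2 - 1) with ((sg * Derive f r) ^ 2)
    by (destruct Hsg as [-> | ->]; ring).
  split; [split; [exact Hbase | nra]|].
  rewrite sqrt_pow2 by lra.
  replace (sg * (sg * Derive f r)) with (Derive f r)
    by (destruct Hsg as [-> | ->]; ring).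
  apply Derive_correct, (Hsmooth 1%nat r Hr).
Qed.

Lemma is_profile_exists (alpha m sg a : R) (b : Rbar) :
  alpha <> 0 -> (alpha = 1 / 2 -> 0 < m) -> Rbar_lt a b ->
  (forall r, open_itv a b r -> formula_defined alpha m r) ->
  exists f, is_profile alpha m sg a b f.
Proof.
  intros Ha Hm Hab Hdef.
  (* The integral starts at an interior point: the right end may be infinite, and the integrand may
     be unbounded there. *)
  destruct (open_itv_nonempty a b Hab) as [c Hc].
  set (g := fun t => sg * sqrt (radicand alpha m t)).
  assert (Hcont : forall t, open_itv a b t -> continuous g t).
  { intros t Ht; apply (continuous_scal_r sg (fun t => sqrt (radicand alpha m t))).
    apply continuous_comp; [|apply continuous_sqrt].
    apply (ex_derive_continuous (V := R_NormedModule)).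
    eexists; apply is_derive_radicand; [exact Ha | exact Hm | apply Hdef, Ht]. }
  exists (fun r => RInt g c r); intros r Hr; split; [exact (Hdef r Hr)|].
  apply (is_derive_RInt g _ c); [|exact (Hcont r Hr)].
  apply filter_imp with (2 := open_itv_open a b r Hr); intros s Hs.
  apply (RInt_correct (V := R_CompleteNormedModule)), ex_RInt_continuous; intros z Hz; apply Hcont.
  destruct (Rle_dec c s) as [H|H].
  - rewrite Rmin_left, Rmax_right in Hz by lra.
    exact (open_itv_between a b c s z Hc Hs Hz).
  - rewrite Rmin_right, Rmax_left in Hz by lra.
    exact (open_itv_between a b s c z Hs Hc Hz).
Qed.

(** Strict positivity of the radicand puts the profile in the range P > 1, where f' is [sg] times
    the monomial (P - 1)^(1/2) and the coefficients of the normal are monomials up to sign. *)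
Lemma profile_is_translator (alpha m sg a : R) (b : Rbar) (f : R -> R) :
  alpha <> 0 -> (sg = 1 \/ sg = -1) -> (alpha = 1 / 2 -> 0 < m) -> 0 <= a ->
  (forall r, open_itv a b r -> 0 < radicand alpha m r) ->
  is_profile alpha m sg a b f -> rotational_translator alpha a b f.
Proof.
  intros Ha Hsg Hm Ha0 Hrad Hf.
  set (I := open_itv a b).
  assert (HI : open I) by apply open_itv_open.
  set (P := fun t => 1 + radicand alpha m t).
  set (beta := 2 - / (2 * alpha)).
  assert (HP1 : forall t, I t -> 1 < P t).
  { intros t Ht; unfold P; specialize (Hrad t Ht); lra. }
  assert (HPode : forall t, I t -> is_derive P t (2 * t * Rpower (P t) beta)).
  { intros t Ht; unfold P; evar_last.
    - apply @is_derive_plus; [apply is_derive_const|].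
      apply is_derive_radicand; [exact Ha | exact Hm | apply (Hf t Ht)].
    - unfold plus, zero; simpl; apply Rplus_0_l. }
  assert (Hmono := monomial_smooth I P beta HI HP1 HPode).
  assert (Hslope : forall t, I t -> Derive f t = sg * sqrt (P t - 1)).
  { intros t Ht; unfold P; rewrite Rplus_minus_l.
    exact (is_derive_unique _ _ _ (proj2 (Hf t Ht))). }
  assert (Hsqrt : forall t, I t ->
            1 + Derive f t ^ 2 = P t /\ sqrt (P t - 1) = monomial P 0 0 (/ 2) t).
  { intros t Ht; specialize (HP1 t Ht); rewrite Hslope by exact Ht; split.
    - rewrite Rpow_mult_distr, pow2_sqrt by lra.
      destruct Hsg as [-> | ->]; ring.
    - unfold monomial; rewrite Rpower_O, Rpower_sqrt by lra; ring. }
  assert (Hinv : forall t, I t -> / sqrt (P t) = Rpower (P t) (- / 2)).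
  { intros t Ht; specialize (HP1 t Ht).
    rewrite Rpower_Ropp, Rpower_sqrt by lra; reflexivity. }
  assert (Hsmooth : forall n r, I r -> ex_derive_n f n r).
  { intros [|n] r Hr; [exact Logic.I|].
    apply ex_derive_n_S_of_is_derive with (fun t => sg * monomial P 0 0 (/ 2) t).
    - apply filter_imp with (2 := HI r Hr); intros s Hs.
      rewrite <- (proj2 (Hsqrt s Hs)), <- (Hslope s Hs).
      apply Derive_correct; eexists; exact (proj2 (Hf s Hs)).
    - apply ex_derive_n_scal_l, Hmono, Hr. }
  assert (Hcst : forall c n t, ex_derive_n (fun _ => c) n t).
  { intros c n t; apply ex_derive_n_const. }
  assert (Hid : forall n t, ex_derive_n (fun s => s) n t).
  { intros [|n] t; [exact Logic.I|].
    apply ex_derive_n_S_of_is_derive with (fun _ => 1); [|apply Hcst].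
    apply filter_forall; intros s; apply @is_derive_id. }
  assert (Hu0 : forall u, I u -> 0 < u) by (intros u [Hu _]; lra).
  split; [exact Hsmooth|split; [|split]].
  - intros n u v Hu; unfold rot_surface, crd1, crd2, crd3; cbn [fst snd].
    repeat split.
    (* The factor 1 gives the first coordinate the product form. *)
    + apply ex_diff_n_ext_loc with (fun s t => f s * 1).
      * apply locally_2d_forall; intros; apply Rmult_1_r.
      * apply (ex_diff_n_separable I f (fun _ => 1)); auto.
    + apply (ex_diff_n_separable I (fun s => s)); [|intros; apply cosh_sinh_smooth|exact Hu].
      auto.
    + apply (ex_diff_n_separable I (fun s => s)); [|intros; apply cosh_sinh_smooth|exact Hu].
      auto.
  - intros u v Hu; apply rot_surface_timelike, Rgt_not_eq, Hu0, Hu.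
  - exists (rot_normal (Derive f)); split; [split|].
    + assert (H1 : forall n t, I t ->
                ex_derive_n (fun s => / sqrt (1 + Derive f s ^ 2)) n t).
      { intros n t Ht; apply ex_derive_n_ext_loc with (monomial P 0 (- / 2) 0).
        - apply filter_imp with (2 := HI t Ht); intros s Hs.
          rewrite (proj1 (Hsqrt s Hs)), Hinv by exact Hs.
          specialize (HP1 s Hs).
          unfold monomial; rewrite (Rpower_O (P s - 1)) by lra; simpl; ring.
        - apply Hmono, Ht. }
      assert (H2 : forall n t, I t ->
                ex_derive_n (fun s => - (Derive f s / sqrt (1 + Derive f s ^ 2))) n t).
      { intros n t Ht.
        apply ex_derive_n_ext_loc with (fun s => - sg * monomial P 0 (- / 2) (/ 2) s).
        - apply filter_imp with (2 := HI t Ht); intros s Hs.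
          unfold Rdiv; rewrite (proj1 (Hsqrt s Hs)), Hinv, Hslope by exact Hs.
          rewrite (proj2 (Hsqrt s Hs)); specialize (HP1 s Hs).
          unfold monomial; rewrite (Rpower_O (P s)) by lra; simpl; ring.
        - apply ex_derive_n_scal_l, Hmono, Ht. }
      intros n u v Hu; unfold rot_normal, crd1, crd2, crd3; cbn [fst snd].
      repeat split.
      * apply ex_diff_n_ext_loc with (fun s t => / sqrt (1 + Derive f s ^ 2) * 1).
        -- apply locally_2d_forall; intros; apply Rmult_1_r.
        -- apply (ex_diff_n_separable I (fun s => / sqrt (1 + Derive f s ^ 2)) (fun _ => 1)); auto.
      * apply (ex_diff_n_separable I
          (fun s => - (Derive f s / sqrt (1 + Derive f s ^ 2))) cosh);
          [exact H2|intros; apply cosh_sinh_smooth|exact Hu].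
      * apply (ex_diff_n_separable I
          (fun s => - (Derive f s / sqrt (1 + Derive f s ^ 2))) sinh);
          [exact H2|intros; apply cosh_sinh_smooth|exact Hu].
    + intros u v _; apply rot_normal_unit.
    + intros u v Hu; specialize (Hu0 u Hu).
      assert (Hd2 : is_derive (Derive f) u (Derive (Derive f) u)).
      { apply Derive_correct; exact (Hsmooth 2%nat u Hu). }
      set (d2 := Derive (Derive f) u) in *.
      assert (HPu : 0 < P u) by (specialize (HP1 u Hu); lra).
      (* Differentiating P = 1 + f'^2 in two ways gives the product f' f'' that the curvature
         contains, without a formula for f''. *)
      assert (E : 2 * Derive f u * d2 = 2 * u * Rpower (P u) beta).
      { rewrite <- (is_derive_unique _ _ _ (HPode u Hu)).
        symmetry; apply is_derive_unique.
        apply is_derive_ext_loc with (fun s => 1 + Derive f s ^ 2).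
        - apply filter_imp with (2 := HI u Hu); intros s Hs; apply (Hsqrt s Hs).
        - evar_last.
          + apply @is_derive_plus; [apply is_derive_const | apply is_derive_pow, Hd2].
          + unfold plus, zero; simpl; ring. }
      (* The value of K is read off from the translator equation K^alpha = P^(-1/2). *)
      exists (Rpower (P u) (- / (2 * alpha))); repeat split.
      * apply (rot_gauss_curvature f I (rot_normal (Derive f)) u v d2);
          [exact HI|auto|exact Hu|lra|exact Hd2|].
        rewrite (proj1 (Hsqrt u Hu)).
        replace (Derive f u * d2) with (u * Rpower (P u) beta) by lra.
        unfold beta.
        replace (2 - / (2 * alpha)) with (- / (2 * alpha) + INR 2) by (simpl; ring).
        rewrite Rpower_plus, Rpower_pow by exact HPu.
        field; split; lra.
      * apply exp_pos.
      * transitivity (/ sqrt (P u)).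
        -- apply Rpower_eq_inv_sqrt_iff; [exact Ha|exact HPu|apply exp_pos|reflexivity].
        -- rewrite <- (proj1 (Hsqrt u Hu)).
           unfold lorentz, rot_normal, crd1, crd2, crd3; simpl; ring.
Qed.

(** * Sign of the radicand and maximal domains *)

Lemma is_maximal_domain_of (alpha m sg a : R) (b : Rbar) :
  alpha <> 0 -> (sg = 1 \/ sg = -1) -> (alpha = 1 / 2 -> 0 < m) ->
  0 <= a -> Rbar_lt a b ->
  (forall t, open_itv a b t ->
     (alpha <> 1 / 2 -> 0 < power_base alpha m t) /\ 0 < radicand alpha m t) ->
  (forall t, 0 < t -> formula_defined alpha m t -> a <= t /\ Rbar_le t b) ->
  is_maximal_domain alpha m sg a b.
Proof.
  intros Ha Hsg Hm Ha0 Hab Hpos Hmax; split.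
  - split; [exact Ha0|split; [exact Hab|split]].
    + apply is_profile_exists; [exact Ha|exact Hm|exact Hab|].
      intros r Hr; destruct (Hpos r Hr) as [H1 H2].
      split; [exact H1 | apply Rlt_le, H2].
    + intros f; apply profile_is_translator; try assumption.
      intros r Hr; apply Hpos, Hr.
  - intros a' b' [Ha' [_ [[f Hf] _]]] r Hr.
    assert (Hdef : forall t, open_itv a' b' t -> a <= t /\ Rbar_le t b).
    { intros t Ht; apply Hmax; [destruct Ht; lra | exact (proj1 (Hf t Ht))]. }
    (* The weak bounds at the neighbours [r - e / 2] and [r + e / 2] become strict bounds at [r]. *)
    destruct (open_itv_open a' b' r Hr) as [e He].
    assert (Hball : forall y, Rabs (y - r) < e -> open_itv a' b' y) by exact He.
    assert (He0 := cond_pos e).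
    split.
    + destruct (Hdef (r - e / 2)) as [H _]; [|lra].
      apply Hball; rewrite Rabs_left; lra.
    + destruct (Hdef (r + e / 2)) as [_ H].
      { apply Hball; rewrite Rabs_right; lra. }
      destruct b as [b| |]; simpl in *; [lra | exact I | contradiction].
Qed.

(** [sqrt] is 0 on negative reals, so [x] may have any sign. *)
Lemma sqrt_lt_pow2 (x t : R) : sqrt x < t -> x < t ^ 2.
Proof.
  intros H; destruct (Rlt_or_le x 0) as [Hx|Hx]; [nra|].
  assert (H0 := sqrt_pos x); rewrite <- (pow2_sqrt x Hx); nra.
Qed.

Lemma pow2_lt_sqrt (x t : R) : 0 <= t -> t < sqrt x -> t ^ 2 < x.
Proof.
  intros Ht H; destruct (Rlt_or_le 0 x) as [Hx|Hx].
  - rewrite <- (pow2_sqrt x) by lra; nra.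
  - rewrite sqrt_neg_0 in H by exact Hx; lra.
Qed.

Lemma sqrt_le_of_pow2 (x t : R) : 0 <= t -> x <= t ^ 2 -> sqrt x <= t.
Proof. intros Ht H; rewrite <- (sqrt_pow2 t Ht); apply sqrt_le_1_alt, H. Qed.

Lemma le_sqrt_of_pow2 (x t : R) : 0 <= t -> t ^ 2 <= x -> t <= sqrt x.
Proof. intros Ht H; rewrite <- (sqrt_pow2 t Ht); apply sqrt_le_1_alt, H. Qed.

Lemma radicand_half_pos_iff (m t : R) : 0 < m ->
  (0 < radicand (1 / 2) m t <-> ln (m ^ 2) < t ^ 2) /\
  (0 <= radicand (1 / 2) m t <-> ln (m ^ 2) <= t ^ 2).
Proof.
  intros Hm; unfold radicand.
  destruct (Req_EM_T (1 / 2) (1 / 2)) as [_|E]; [|contradiction].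
  assert (Hm2 : 0 < m ^ 2) by (apply pow_lt, Hm).
  assert (E : 1 / m ^ 2 * exp (t ^ 2) = exp (t ^ 2 - ln (m ^ 2))).
  { unfold Rminus; rewrite exp_plus, exp_Ropp, exp_ln by exact Hm2.
    field; lra. }
  rewrite E; set (y := t ^ 2 - ln (m ^ 2)); assert (E0 := exp_0).
  assert (Hexp : (0 < y -> 1 < exp y) /\ (y < 0 -> exp y < 1)).
  { split; intros Hy; apply exp_increasing in Hy; lra. }
  destruct (Rtotal_order y 0) as [H|[H|H]].
  - unfold y in *; split; split; intros; lra.
  - rewrite H; unfold y in *; split; split; intros; lra.
  - unfold y in *; split; split; intros; lra.
Qed.

(** x^q - 1 has the sign of q ln x, and ln x that of x - 1. Replacing the logarithm leaves a
    condition polynomial in [t]. *)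
Lemma radicand_pos_iff_base (alpha m t : R) :
  alpha <> 1 / 2 -> 0 < power_base alpha m t ->
  (0 < radicand alpha m t <->
   0 < 2 * alpha / (1 - 2 * alpha) * (power_base alpha m t - 1)) /\
  (0 <= radicand alpha m t <->
   0 <= 2 * alpha / (1 - 2 * alpha) * (power_base alpha m t - 1)).
Proof.
  intros Ha Hx; unfold radicand, Rpower.
  destruct (Req_EM_T alpha (1 / 2)) as [E|_]; [contradiction|].
  set (x := power_base alpha m t) in *.
  set (q := 2 * alpha / (1 - 2 * alpha)).
  assert (E0 := exp_0).
  assert (Hexp : (0 < q * ln x -> 1 < exp (q * ln x)) /\
                 (q * ln x < 0 -> exp (q * ln x) < 1)).
  { split; intros Hy; apply exp_increasing in Hy; lra. }
  assert (Hln : (1 < x -> 0 < ln x) /\ (x < 1 -> ln x < 0)).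
  { split; intros H.
    - rewrite <- ln_1; apply ln_increasing; lra.
    - rewrite <- ln_1; apply ln_increasing; lra. }
  destruct (Rtotal_order x 1) as [H|[H|H]].
  - apply Hln in H as H'.
    destruct (Rtotal_order q 0) as [Hq|[->|Hq]]; [|rewrite !Rmult_0_l; lra|].
    + assert (0 < q * ln x) by nra; assert (0 < q * (x - 1)) by nra.
      split; split; intros; lra.
    + assert (q * ln x < 0) by nra; assert (q * (x - 1) < 0) by nra.
      split; split; intros; lra.
  - rewrite H, ln_1, Rmult_0_r, Rminus_diag, Rmult_0_r; lra.
  - apply Hln in H as H'.
    destruct (Rtotal_order q 0) as [Hq|[->|Hq]]; [|rewrite !Rmult_0_l; lra|].
    + assert (q * ln x < 0) by nra; assert (q * (x - 1) < 0) by nra.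
      split; split; intros; lra.
    + assert (0 < q * ln x) by nra; assert (0 < q * (x - 1)) by nra.
      split; split; intros; lra.
Qed.

Lemma radicand_pos_iff_sqr (alpha m t : R) :
  alpha <> 0 -> alpha <> 1 / 2 -> 0 < power_base alpha m t ->
  (0 < radicand alpha m t <->
   2 * alpha / (2 * alpha - 1) * (m - 1) < t ^ 2) /\
  (0 <= radicand alpha m t <->
   2 * alpha / (2 * alpha - 1) * (m - 1) <= t ^ 2).
Proof.
  intros Ha0 Ha Hx.
  assert (H1 : 1 - 2 * alpha <> 0) by lra.
  (* With q the exponent in [radicand], [power_base] is m + t^2 / q. Multiplying by q makes the
     coefficient of t^2 equal to 1, so the inequality has one form for both signs of q. *)
  replace (2 * alpha / (2 * alpha - 1) * (m - 1))
    with (t ^ 2 - 2 * alpha / (1 - 2 * alpha) * (power_base alpha m t - 1))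
    by (unfold power_base; field; repeat split; lra).
  destruct (radicand_pos_iff_base alpha m t Ha Hx) as [-> ->].
  split; split; intros; lra.
Qed.

Lemma power_base_pos_iff (alpha m t : R) : alpha < 0 \/ 1 / 2 < alpha ->
  0 < power_base alpha m t <-> t ^ 2 < 2 * alpha / (2 * alpha - 1) * m.
Proof.
  intros Ha; set (q := 2 * alpha / (2 * alpha - 1)).
  assert (Hq : 0 < q).
  { unfold q; destruct Ha.
    - replace (2 * alpha / (2 * alpha - 1)) with (- (2 * alpha) / (1 - 2 * alpha))
        by (field; lra).
      apply Rdiv_lt_0_compat; lra.
    - apply Rdiv_lt_0_compat; lra. }
  replace (power_base alpha m t) with ((q * m - t ^ 2) / q)
    by (unfold power_base, q; field; lra).
  split; intros H.
  - apply (Rmult_lt_compat_l q) in H; [|exact Hq].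
    replace (q * ((q * m - t ^ 2) / q)) with (q * m - t ^ 2) in H by (field; lra).
    lra.
  - apply Rdiv_lt_0_compat; lra.
Qed.

Theorem theorem4p8 (alpha : R) (alpha_neq0 : alpha <> 0) :
  (forall (a : R) (b : Rbar) (f : R -> R),
     0 <= a -> Rbar_lt a b -> rotational_translator alpha a b f ->
     exists sg m : R,
       (sg = 1 \/ sg = -1) /\
       (alpha = 1 / 2 -> 0 < m) /\
       is_profile alpha m sg a b f) /\
  (forall sg m : R, (sg = 1 \/ sg = -1) ->
     (alpha = 1 / 2 ->
        (0 < m <= 1 -> is_maximal_domain alpha m sg 0 p_infty) /\
        (1 < m ->
           is_maximal_domain alpha m sg (sqrt (ln (m ^ 2))) p_infty)) /\
     (0 < alpha < 1 / 2 ->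
        (1 <= m -> is_maximal_domain alpha m sg 0 p_infty) /\
        (m < 1 ->
           is_maximal_domain alpha m sg
             (sqrt (2 * alpha / (1 - 2 * alpha) * (1 - m))) p_infty)) /\
     (alpha < 0 \/ 1 / 2 < alpha ->
        (0 < m <= 1 ->
           is_maximal_domain alpha m sg
             0 (sqrt (2 * alpha / (2 * alpha - 1) * m))) /\
        (1 < m ->
           is_maximal_domain alpha m sg
             (sqrt (2 * alpha / (2 * alpha - 1) * (m - 1)))
             (sqrt (2 * alpha / (2 * alpha - 1) * m))) /\
        (m <= 0 ->
           forall (a : R) (b : Rbar), ~ admissible_domain alpha m sg a b))).
Proof.
  split; [intros; apply translator_is_profile; assumption|].
  intros sg m Hsg; split; [|split].
  - intros ->; split; intros Hm.
    + apply is_maximal_domain_of; try lra; [exact I| |].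
      * intros t [Ht _]; split; [lra|].
        apply radicand_half_pos_iff; [lra|].
        apply Rle_lt_trans with 0; [|nra].
        rewrite <- ln_1; apply ln_le; nra.
      * intros t Ht _; split; [lra | exact I].
    + apply is_maximal_domain_of; try lra; [apply sqrt_pos|exact I| |].
      * intros t [Ht _]; split; [lra|].
        apply radicand_half_pos_iff; [lra | apply sqrt_lt_pow2, Ht].
      * intros t Ht [_ H]; split; [|exact I].
        apply sqrt_le_of_pow2; [lra|].
        apply radicand_half_pos_iff; [lra | exact H].
  - intros Ha.
    set (q := 2 * alpha / (1 - 2 * alpha)).
    assert (Hq : 0 < q) by (apply Rdiv_lt_0_compat; lra).
    assert (Hqm : 2 * alpha / (2 * alpha - 1) * (m - 1) = q * (1 - m))
      by (unfold q; field; lra).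
    (* In this range a positive radicand forces the base above 1, so positivity of the base gives no
       upper bound on [t]. *)
    assert (Hbase : forall t, power_base alpha m t = 1 + (t ^ 2 - q * (1 - m)) / q)
      by (intros t; unfold power_base, q; field; lra).
    assert (Hpos : forall t, q * (1 - m) < t ^ 2 ->
              0 < power_base alpha m t /\ 0 < radicand alpha m t).
    { intros t Ht; assert (H : 0 < power_base alpha m t).
      { rewrite Hbase; apply Rplus_lt_0_compat; [lra|].
        apply Rdiv_lt_0_compat; lra. }
      split; [exact H|].
      apply radicand_pos_iff_sqr; [lra|lra|exact H|rewrite Hqm; exact Ht]. }
    split; intros Hm; apply is_maximal_domain_of; try lra; try exact I.
    + intros t [Ht _]; destruct (Hpos t) as [H1 H2]; [nra | auto].
    + intros t Ht _; split; [lra | exact I].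
    + apply sqrt_pos.
    + intros t [Ht _]; destruct (Hpos t (sqrt_lt_pow2 _ _ Ht)); auto.
    + intros t Ht [H1 H2]; split; [|exact I].
      apply sqrt_le_of_pow2; [lra|]; rewrite <- Hqm.
      apply radicand_pos_iff_sqr; [lra|lra|apply H1; lra|exact H2].
  - intros Ha.
    assert (Hbase := fun t => power_base_pos_iff alpha m t Ha).
    assert (Hrad := fun t =>
      radicand_pos_iff_sqr alpha m t alpha_neq0 ltac:(lra)).
    set (q := 2 * alpha / (2 * alpha - 1)) in *.
    assert (Hq : 0 < q).
    (* At [m = 1] and [t = 0] the base is 1, and its positivity criterion reads [0 < q]. *)
    { destruct (power_base_pos_iff alpha 1 0 Ha) as [H _].
      fold q in H; assert (0 < power_base alpha 1 0) by (unfold power_base; lra).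
      specialize (H ltac:(assumption)); lra. }
    (* Both constraints are active here: the radicand bounds [t] from below, the base from above. *)
    assert (Hmax : forall t, 0 < t -> formula_defined alpha m t ->
              q * (m - 1) <= t ^ 2 /\ t <= sqrt (q * m)).
    { intros t Ht [H1 H2]; specialize (H1 ltac:(lra)); split.
      - apply Hrad; assumption.
      - apply le_sqrt_of_pow2; [lra|]; apply Rlt_le, Hbase, H1. }
    assert (Hpos : forall t, 0 <= t -> t < sqrt (q * m) -> q * (m - 1) < t ^ 2 ->
              (alpha <> 1 / 2 -> 0 < power_base alpha m t) /\
              0 < radicand alpha m t).
    { intros t Ht0 Ht H; assert (H1 : 0 < power_base alpha m t).
      { apply Hbase, pow2_lt_sqrt; assumption. }
      split; [auto | apply Hrad; assumption]. }
    split; [|split]; intros Hm.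
    + apply is_maximal_domain_of; try lra.
      * simpl; apply sqrt_lt_R0; nra.
      * intros t [Ht1 Ht2]; simpl in Ht2; apply Hpos; [lra|exact Ht2|nra].
      * intros t Ht Hdef; split; [lra | apply Hmax; assumption].
    + apply is_maximal_domain_of; try lra; [apply sqrt_pos| | |].
      * simpl; apply sqrt_lt_1; nra.
      * intros t [Ht1 Ht2]; simpl in Ht2.
        assert (H0 := sqrt_pos (q * (m - 1))).
        apply Hpos; [lra|exact Ht2|apply sqrt_lt_pow2, Ht1].
      * intros t Ht Hdef; destruct (Hmax t Ht Hdef) as [H1 H2].
        split; [apply sqrt_le_of_pow2; lra | exact H2].
    (* For [m <= 0] a positive base would require [r ^ 2 < q * m <= 0]. *)
    + intros a b [_ [Hab [[f Hf] _]]].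
      destruct (open_itv_nonempty a b Hab) as [r Hr].
      destruct (Hf r Hr) as [[H _] _].
      assert (Hlt := proj1 (Hbase r) (H ltac:(lra))); nra.
Qed.
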